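(* Let $k\ge 3$ be an integer and let $d$ be a positive real number. Let $\mathcal{C}_{k,d}$ be the class of graphs of maximum average degree at most $d$ that do not contain the $1$-subdivision of the complete graph $K_k$ as a subgraph. Then $\mathcal{C}_{k,d}$ has domination tied to 2-independence; that is, there exists a function $h$ such that $\gamma(G)\le h(\alpha_2(G))$ holds for every graph $G\in\mathcal{C}_{k,d}$.
   Context: Graphs are finite, simple and undirected. The maximum average degree of a graph is the maximum of the average degrees of its (nonempty) subgraphs. The $1$-subdivision of a graph $F$ is the graph obtained from $F$ by subdividing each edge exactly once. ''Subgraph'' means not necessarily induced subgraph. For a graph $G$, the domination number $\gamma(G)$ is the minimum size of a set $D\subseteq V(G)$ such that every vertex of $G$ belongs to $D$ or has a neighbor in $D$. The 2-independence number $\alpha_2(G)$ is the maximum size of a set $A\subseteq V(G)$ such that the distance in $G$ between any two distinct vertices of $A$ is greater than two (vertices in different components are at infinite distance). *)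

(* Defs.v *)
From mathcomp Require Import all_boot all_order all_algebra.
From mathcomp Require Import reals.

Set Implicit Arguments.
Unset Strict Implicit.
Unset Printing Implicit Defensive.

Import Order.TTheory GRing.Theory Num.Theory.

Record sgraph := SGraph {
  vertex :> finType;
  adj : rel vertex;
  adj_sym : symmetric adj;
  adj_irr : irreflexive adj }.

Definition edges (G : sgraph) : {set {set G}} :=
  [set [set p.1; p.2] | p in [set p : G * G | adj p.1 p.2]].

(* The vertex set A and the edge set B form a (not necessarily induced)
   subgraph of G. *)
Definition is_subgraph (G : sgraph) (A : {set G}) (B : {set {set G}}) : bool :=
  (B \subset edges G) && [forall e in B, e \subset A].

Definition avg_degree (R : realType) (G : sgraph)
    (A : {set G}) (B : {set {set G}}) : R :=
  ((\sum_(v in A) #|[set e in B | v \in e]|)%:R / #|A|%:R)%R.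

(* Average degrees are nonnegative, so the base value 0 only matters for the
   graph without vertices, whose maximum average degree is set to 0. *)
Definition mad (R : realType) (G : sgraph) : R :=
  (\big[Num.max/0]_(S : {set G} * {set {set G}}
      | is_subgraph S.1 S.2 && (S.1 != set0)) avg_degree R S.1 S.2)%R.

(* G has a subgraph isomorphic to H. *)
Definition contains_subgraph (G H : sgraph) : Prop :=
  exists f : H -> G,
    injective f /\ forall x y : H, adj x y -> adj (f x) (f y).

Definition complete_adj (k : nat) : rel 'I_k := fun x y => x != y.

Lemma complete_adj_sym (k : nat) : symmetric (@complete_adj k).
Proof. by move=> x y; rewrite /complete_adj eq_sym. Qed.

Lemma complete_adj_irr (k : nat) : irreflexive (@complete_adj k).
Proof. by move=> x; rewrite /complete_adj eqxx. Qed.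

Definition complete_graph (k : nat) : sgraph :=
  SGraph (@complete_adj_sym k) (@complete_adj_irr k).

(* The vertices of the 1-subdivision are those of F together with one vertex
   per edge of F, adjacent to the two ends of that edge. *)
Definition subdiv_vertex (F : sgraph) : finType :=
  (F + {e : {set F} | e \in edges F})%type.

Definition subdiv_adj (F : sgraph) : rel (subdiv_vertex F) := fun u w =>
  match u, w with
  | inl x, inr e => x \in val e
  | inr e, inl x => x \in val e
  | _, _ => false
  end.

Lemma subdiv_adj_sym (F : sgraph) : symmetric (@subdiv_adj F).
Proof. by case=> [x|e] [y|e']. Qed.

Lemma subdiv_adj_irr (F : sgraph) : irreflexive (@subdiv_adj F).
Proof. by case. Qed.

Definition subdivision1 (F : sgraph) : sgraph :=
  SGraph (@subdiv_adj_sym F) (@subdiv_adj_irr F).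

Definition has_walk (G : sgraph) (n : nat) (x y : G) : bool :=
  [exists p : n.-tuple G, path (@adj G) x p && (last x p == y)].

(* [None] is the infinite distance. A shortest walk is a path, hence its length
   is less than #|G| and the search range is large enough. *)
Definition dist (G : sgraph) (x y : G) : option nat :=
  omap val [pick n : 'I_#|G| | has_walk n x y &
                               [forall m : 'I_n, ~~ has_walk m x y]].

Definition dist_gt (G : sgraph) (n : nat) (x y : G) : bool :=
  if dist x y is Some m then n < m else true.

Definition dominating (G : sgraph) (D : {set G}) : bool :=
  [forall v, (v \in D) || [exists u in D, adj v u]].

(* The whole vertex set is dominating, so this is a genuine minimum. *)
Definition domination_number (G : sgraph) : nat :=
  #|[arg min_(D < [set: G] | dominating D) #|D| ]|.

Definition two_independent (G : sgraph) (A : {set G}) : bool :=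
  [forall x in A, forall y in A, (x != y) ==> dist_gt 2 x y].

Definition two_independence_number (G : sgraph) : nat :=
  \max_(A : {set G} | two_independent A) #|A|.

Definition class_C (R : realType) (k : nat) (d : R) (G : sgraph) : Prop :=
  (mad R G <= d)%R /\
  ~ contains_subgraph G (subdivision1 (complete_graph k)).

Definition domination_tied_to_2independence (C : sgraph -> Prop) : Prop :=
  exists h : nat -> nat, forall G : sgraph,
    C G -> domination_number G <= h (two_independence_number G).

(* Main.v *)
(** The domination number and the 2-independence number are the transversal and
    the matching number of the hypergraph of closed neighbourhoods.  Bounded
    maximum average degree gives an orientation of bounded outdegree, by which a
    fractional dominating set of weight [t] can be rounded to a dominating set of
    size [O(t)].  If the domination number is large, there is thus no fractional
    dominating set of small weight, and multiplicative weights produce a long sequence of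
    vertices whose closed neighbourhoods cover no vertex more than a small
    fraction of the time.  In a random sample of [M] terms of this sequence,
    a common neighbour chosen for two of the terms is, with positive
    probability, never in the closed neighbourhood of a third one.  By Ramsey's
    theorem the sample contains either many vertices with pairwise disjoint
    closed neighbourhoods, or [k] vertices whose closed neighbourhoods pairwise
    intersect, and then the chosen common neighbours subdivide a [K_k]. *)

Require Import Defs.
From mathcomp Require Import all_boot all_order all_algebra.
From mathcomp Require Import reals.
From mathcomp Require Import zify.

Set Implicit Arguments.
Unset Strict Implicit.
Unset Printing Implicit Defensive.

Import Order.TTheory GRing.Theory Num.Theory.

(** * Ramsey's theorem with an exponential bound *)

(** Induction on [a + b]: removing a vertex [x] from [A] leaves its neighbours and its
    non-neighbours, and one of these two sets has at least half of [2 ^ (a + b)] elements. *)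
Lemma ramsey (T : finType) (e : rel T) (a b : nat) (A : {set T}) :
  symmetric e -> 2 ^ (a + b) <= #|A| ->
  (exists S : {set T}, [/\ S \subset A, #|S| = a &
     {in S &, forall x y, x != y -> e x y}]) \/
  (exists S : {set T}, [/\ S \subset A, #|S| = b &
     {in S &, forall x y, x != y -> ~~ e x y}]).
Proof.
move=> e_sym.
have [n] := ubnP (a + b); elim: n => // n IHn in a b A *.
case: a => [|a] lt_n leA.
  by left; exists set0; rewrite sub0set cards0; split=> // x y; rewrite inE.
case: b => [|b] in lt_n leA *.
  by right; exists set0; rewrite sub0set cards0; split=> // x y; rewrite inE.
have [x xA] : exists x, x \in A.
  by apply/card_gt0P; apply: leq_trans leA; rewrite expn_gt0.
pose A1 := [set y in A | (y != x) && e x y].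
pose A2 := [set y in A | (y != x) && ~~ e x y].
have cA : #|A| = (#|A1| + #|A2|).+1.
  rewrite (cardsD1 x) xA add1n; congr _.+1.
  rewrite -(cardsID [set y | e x y] (A :\ x)); congr (_ + _);
    by apply: eq_card => y; rewrite !inE; case: (y != x); case: (y \in A); case: (e x y).
have extend (S : {set T}) (s : bool) :
    S \subset [set y in A | (y != x) && (e x y == s)] ->
    {in S &, forall y z, y != z -> e y z = s} ->
    [/\ x |: S \subset A, #|x |: S| = #|S|.+1 &
     {in x |: S &, forall y z, y != z -> e y z = s}].
  move=> /subsetP sS eS; split.
  - apply/subsetP=> y; rewrite !inE => /orP[/eqP->//|/sS].
    by rewrite inE => /andP[].
  - rewrite cardsU1; case: (boolP (x \in S)) => // /sS.
    by rewrite !inE eqxx andbF.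
  - move=> y z /setU1P[->|yS] /setU1P[->|zS] neq.
    + by rewrite eqxx in neq.
    + by move/sS: zS; rewrite inE => /and3P[_ _ /eqP].
    + by rewrite e_sym; move/sS: yS; rewrite inE => /and3P[_ _ /eqP].
    + exact: eS.
have pow2 : 2 ^ (a.+1 + b.+1) = 2 ^ (a + b.+1) + 2 ^ (a.+1 + b).
  by rewrite addSn expnS addnS addSn mul2n addnn.
have [le1|lt1] := leqP (2 ^ (a + b.+1)) #|A1|.
  have [|[S [sS cS eS]]|[S [sS cS eS]]] := IHn a b.+1 A1 _ le1.
  - by move: lt_n; rewrite addSn ltnS.
  - left; have [||s1 s2 s3] := extend S true.
    + by apply: subset_trans sS _; apply/subsetP=> y; rewrite !inE eqb_id.
    + exact: eS.
    + by exists (x |: S); rewrite s2 cS.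
  - right; exists S; split=> //; apply: subset_trans sS _.
    by apply/subsetP=> y; rewrite inE => /andP[].
have le2 : 2 ^ (a.+1 + b) <= #|A2| by lia.
have [|[S [sS cS eS]]|[S [sS cS eS]]] := IHn a.+1 b A2 _ le2.
- by move: lt_n; rewrite addnS ltnS.
- left; exists S; split=> //; apply: subset_trans sS _.
  by apply/subsetP=> y; rewrite inE => /andP[].
- right; have [||s1 s2 s3] := extend S false.
  + by apply: subset_trans sS _; apply/subsetP=> y; rewrite !inE eqbF_neg.
  + by move=> y z yS zS yz; apply/negbTE/eS.
  + exists (x |: S); rewrite s2 cS; split=> // y z yS zS yz.
    by rewrite (s3 y z).
Qed.

(** * Degeneracy and orientations of bounded outdegree *)

(** A vertex with at most [D] neighbours in [A] gets all its edges into [A] directed outwards; the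
    rest of [A] is oriented by induction. *)
Lemma orientation_of_degenerate (T : finType) (e : rel T) (D : nat) :
  symmetric e ->
  (forall A : {set T}, A != set0 ->
     exists2 v, v \in A & #|[set u in A | e v u]| <= D) ->
  exists o : rel T, [/\ subrel o e, forall u v, e u v -> o u v || o v u &
    forall u, #|[set v | o u v]| <= D].
Proof.
move=> e_sym degen.
suff orient n : forall A : {set T}, #|A| <= n -> exists o : rel T,
    [/\ subrel o e, {in A &, forall u v, e u v -> o u v || o v u} &
    forall u, #|[set v | o u v]| <= D].
  have [o [oe eo oD]] := orient _ [set: T] (leqnn _).
  by exists o; split=> // u v; apply: eo.
elim: n => [|n IHn] A leA.
  exists (fun _ _ => false); split=> // [u v|u].
    by move: leA; rewrite leqn0 cards_eq0 => /eqP->; rewrite inE.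
  by rewrite (_ : [set v | false] = set0) ?cards0 //; apply/setP=> v; rewrite !inE.
have [->|A0] := eqVneq A set0; first by apply: IHn; rewrite cards0.
have [x xA dx] := degen A A0.
have [|o [oe eo oD]] := IHn (A :\ x).
  by move: leA; rewrite (cardsD1 x) xA.
exists (fun u v => if u == x then (v \in A) && e x v else o u v); split.
- by move=> u v /=; case: eqP => [-> /andP[]|_ /oe].
- move=> u v uA vA euv /=; case: eqP => [ux|/eqP ux].
    by rewrite -ux euv vA.
  case: eqP => [vx|/eqP vx]; first by rewrite uA -vx e_sym euv orbT.
  by apply: eo => //; rewrite !inE ?ux ?vx.
- move=> u; case: eqP => [_|_]; last exact: oD.
  by apply: leq_trans dx; apply: subset_leq_card; apply/subsetP=> v; rewrite !inE.
Qed.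

(** The subgraph induced on [A] has average degree at most [mad R G], and some vertex does not
    exceed the average. *)
Lemma mad_degenerate (R : realType) (d : R) (D : nat) (G : sgraph)
    (A : {set G}) :
  (d <= D%:R)%R -> (mad R G <= d)%R -> A != set0 ->
  exists2 v, v \in A & #|[set u in A | adj v u]| <= D.
Proof.
move=> dD madG A0.
pose B := [set e in edges G | e \subset A].
have sumB : \sum_(v in A) #|[set e in B | v \in e]| <= D * #|A|.
  rewrite -(ler_nat R) natrM -ler_pdivrMr ?ltr0n ?card_gt0 //.
  apply: le_trans dD; apply: le_trans madG.
  rewrite /mad -[leLHS]/(avg_degree R (A, B).1 (A, B).2).
  apply: (@le_bigmax_cond _ _ _ _ _ _ (fun S => avg_degree R S.1 S.2)) => /=.
  rewrite A0 andbT /is_subgraph; apply/andP; split.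
    by apply/subsetP=> e; rewrite inE => /andP[].
  by apply/forall_inP=> e; rewrite inE => /andP[].
have [v vA degv] : exists2 v, v \in A & #|[set e in B | v \in e]| <= D.
  apply/exists_inP; apply: contraLR sumB; rewrite negb_exists_in -ltnNge.
  move=> /forall_inP big; apply: (@leq_trans (\sum_(v in A) D.+1)).
    by rewrite sum_nat_const [leqRHS]mulnC ltn_pmul2r // card_gt0.
  by apply: leq_sum => v /big; rewrite -ltnNge.
exists v => //; apply: leq_trans degv.
(* Degrees in [mad] count incident edges; distinct neighbours of [v] give distinct edges. *)
have inj : {in [set u in A | adj v u] &, injective (fun u => [set v; u])}.
  move=> u w; rewrite !inE => /andP[_ vu] /andP[_ vw] /setP/(_ u).
  rewrite !inE eqxx orbT; case: eqP => [uv|_ /= /esym/eqP//].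
  by rewrite uv adj_irr in vu.
rewrite -(card_in_imset inj); apply: subset_leq_card.
apply/subsetP=> _ /imsetP[u + ->]; rewrite !inE eqxx andbT => /andP[uA vu].
apply/andP; split; last by apply/subsetP=> x /set2P[]->.
by apply/imsetP; exists (v, u); rewrite ?inE.
Qed.

(** * Rounding of fractional dominating sets *)

Definition closed_nbhd (G : sgraph) (v : G) : {set G} :=
  [set u | (u == v) || adj v u].

Lemma closed_nbhd_refl (G : sgraph) (v : G) : v \in closed_nbhd v.
Proof. by rewrite inE eqxx. Qed.

Lemma domination_number_le (G : sgraph) (D : {set G}) :
  dominating D -> domination_number G <= #|D|.
Proof.
move=> domD; rewrite /domination_number; case: arg_minnP => [|S _]; last exact.
by apply/forallP=> v; rewrite inE.
Qed.

Lemma card_markov (T : finType) (f : T -> nat) (W c : nat) :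
  0 < W -> \sum_x f x <= c * W -> #|[set x | W <= f x]| <= c.
Proof.
move=> W0 le_c; rewrite -(leq_pmul2r W0); apply: leq_trans le_c.
rewrite -sum_nat_const big_mkcond [leqRHS]big_mkcond /=.
by apply: leq_sum => x _; rewrite inE; case: ifP.
Qed.

(** [D1] collects the heavy vertices and [D2] those with a heavy in-neighbourhood; both are small by
    double counting. A closed neighbourhood weighs at least [W / t], so for [v] outside [D2] more
    than [W / (2t)] lies on [v] and its out-neighbours. One of these at most [D + 1] vertices is
    then in [D1]. *)
Lemma fractional_domination_rounding (G : sgraph) (o : rel G) (D t : nat)
    (w : G -> nat) :
  subrel o (@adj G) -> (forall u v : G, adj u v -> o u v || o v u) ->
  (forall u, #|[set v | o u v]| <= D) ->
  0 < \sum_v w v ->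
  (forall u, \sum_v w v <= t * \sum_(v in closed_nbhd u) w v) ->
  domination_number G <= (4 * D + 2) * t.
Proof.
move=> o_adj adj_o oD; set W := \sum_v w v => W0 fracW.
pose D1 := [set u | W <= 2 * D.+1 * t * w u].
pose D2 := [set v | W <= 2 * t * \sum_(u | o u v) w u].
have cD1 : #|D1| <= 2 * D.+1 * t.
  by apply: card_markov => //; rewrite -big_distrr.
have cD2 : #|D2| <= 2 * t * D.
  apply: card_markov => //; rewrite -big_distrr /= -[leqRHS]mulnA leq_mul2l.
  apply/orP; right; rewrite (exchange_big_dep predT) //= big_distrr /=.
  apply: leq_sum => u _; rewrite sum_nat_const leq_mul2r; apply/orP; right.
  by apply: leq_trans (oD u); rewrite cardsE.
apply: (@leq_trans #|D1 :|: D2|); last first.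
  apply: leq_trans (leq_card_setU _ _) _.
  by apply: leq_trans (leq_add cD1 cD2) _; lia.
apply: domination_number_le; apply/forallP=> v.
rewrite in_setU; have [_|] := boolP (v \in D2); first by rewrite orbT.
rewrite inE -ltnNge orbF => small_in.
pose S := v |: [set u | o v u].
have cS : #|S| <= D.+1.
  by apply: leq_trans (leq_card_setU _ _) _; rewrite cards1 add1n ltnS.
have splitN : \sum_(u in closed_nbhd v) w u <=
    \sum_(u in S) w u + \sum_(u | o u v) w u.
  rewrite big_mkcond [X in X + _]big_mkcond [X in _ + X]big_mkcond -big_split /=.
  apply: leq_sum => u _; rewrite !inE.
  case: eqP => //= _; first by rewrite leq_addr.
  case: (boolP (adj v u)) => // /adj_o.
  by case: (o v u) => /= [|->]; rewrite ?leq_addr ?leq_addl.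
have [u uS wu] : exists2 u, u \in S & W <= 2 * D.+1 * t * w u.
  apply/exists_inP; apply: contraLR small_in.
  rewrite negb_exists_in -leqNgt => /forall_inP light.
  have lightS : D.+1 * (2 * t * \sum_(u in S) w u) <= D.+1 * W.
    apply: (@leq_trans (\sum_(u in S) W)); last by rewrite sum_nat_const leq_mul2r cS orbT.
    rewrite mulnA big_distrr /=; apply: leq_sum => u /light.
    by rewrite -ltnNge => /ltnW; congr (_ <= _); lia.
  rewrite leq_pmul2l // in lightS.
  have := fracW v; move: splitN lightS; clear light.
  move: (\sum_(u in S) w u) (\sum_(u | o u v) w u).
  by move: (\sum_(u in closed_nbhd v) w u) => x y z; nia.
have uD1 : u \in D1 by rewrite inE.
move: uS; rewrite !inE => /predU1P[<-|vu]; first by rewrite wu.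
apply/orP; right; apply/exists_inP; exists u; last exact: o_adj.
by rewrite !inE wu.
Qed.

(** * Sparse sequences by multiplicative weights *)

(* Starting from weight 1, each chosen [u] is light for the current weights and
   doubles the weight of every element of [N u]. *)
Lemma multiplicative_weights (T : finType) (N : T -> {set T}) (t s : nat) :
  (forall w : T -> nat, 0 < \sum_v w v ->
     exists u, t * \sum_(v in N u) w v <= \sum_v w v) ->
  0 < #|T| ->
  exists us : s.-tuple T,
    t ^ s * \sum_v 2 ^ count (fun u => v \in N u) us <= t.+1 ^ s * #|T|.
Proof.
move=> light T0; elim: s => [|s [us leW]].
  by exists [tuple]; rewrite !mul1n /= sum1_card.
pose w v := 2 ^ count (fun u => v \in N u) us.
have [|u lightu] := light w.
  have /card_gt0P[x _] := T0.
  by rewrite (bigD1 x) //= addn_gt0 expn_gt0.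
exists [tuple of u :: us] => /=.
have -> : \sum_v 2 ^ ((v \in N u) + count (fun u => v \in N u) us) =
    \sum_v w v + \sum_(v in N u) w v.
  rewrite [X in _ + X]big_mkcond -big_split /=; apply: eq_bigr => v _.
  by rewrite expnD /w; case: (v \in N u); rewrite ?mul2n ?addnn ?mul1n ?addn0.
apply: (@leq_trans (t ^ s * (t.+1 * \sum_v w v))).
  rewrite expnSr -mulnA leq_mul2l mulnDr mulSn addnC leq_add2r lightu.
  by rewrite orbT.
by rewrite mulnCA expnS -mulnA leq_mul2l leW orbT.
Qed.

(** This is [(1 + 1/t)^q <= 2] for [t = 2q], obtained from [(1 + 1/t)^j (1 - j/t) <= 1] at
    [j = q]. *)
Lemma bernoulli_2q (q : nat) : 0 < q -> (2 * q).+1 ^ q <= 2 * (2 * q) ^ q.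
Proof.
move=> q0; set t := 2 * q.
have ind j : j <= t -> t.+1 ^ j * (t - j) <= t ^ j.+1.
  elim: j => [|j IHj] ltj; first by rewrite subn0 mul1n.
  rewrite expnSr -mulnA [t ^ j.+2]expnSr.
  apply: leq_trans (leq_mul (IHj (ltnW ltj)) (leqnn t)).
  rewrite -mulnA leq_mul2l; apply/orP; right.
  by move: (t) ltj => u ltj; nia.
have := ind q (leq_pmull q (isT : 0 < 2)).
have -> : t - q = q by rewrite /t; lia.
have -> : t ^ q.+1 = 2 * t ^ q * q by rewrite expnSr {2}/t mulnCA mulnA.
by rewrite leq_pmul2r.
Qed.

(** With [n = #|T|], the final total weight is at most [(1 + 1/(2q))^(qn) n <= 2^n n], whereas an
    element covered [2n] times would alone weigh [4^n]. *)
Lemma sparse_tuple (T : finType) (N : T -> {set T}) (q : nat) :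
  0 < q -> 0 < #|T| ->
  (forall w : T -> nat, 0 < \sum_v w v ->
     exists u, 2 * q * \sum_(v in N u) w v <= \sum_v w v) ->
  exists us : (q * #|T|).-tuple T,
    forall v, count (fun u => v \in N u) us < 2 * #|T|.
Proof.
move=> q0 T0 /multiplicative_weights/(_ T0) MW.
have [us leW] := MW (q * #|T|).
exists us => v; rewrite ltnNge; apply/negP=> many.
have bern : (2 * q).+1 ^ (q * #|T|) <= 2 ^ #|T| * (2 * q) ^ (q * #|T|).
  by rewrite !expnM -expnMn leq_exp2r // bernoulli_2q.
have : 2 ^ #|T| * (2 * q) ^ (q * #|T|) * 2 ^ #|T| <=
    2 ^ #|T| * (2 * q) ^ (q * #|T|) * #|T|.
  apply: leq_trans (leq_mul bern (leqnn _)); apply: leq_trans leW.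
  rewrite mulnAC mulnC leq_mul2l -expnD addnn -mul2n; apply/orP; right.
  by rewrite (bigD1 v) //= (leq_trans _ (leq_addr _ _)) // leq_exp2l.
rewrite leq_pmul2l ?muln_gt0 ?expn_gt0 ?muln_gt0 ?q0 //.
by rewrite leqNgt ltn_expl.
Qed.

(** * Random sampling *)

Lemma count_tnth (T : Type) (n : nat) (us : n.-tuple T) (P : pred T) :
  #|[set i | P (tnth us i)]| = count P us.
Proof. by rewrite cardsE -sum1_card -sum1_count big_tuple. Qed.

(** Union bound over the [M ^ 3] triples: for each, [f l] falls into [B (f i) (f j)] with
    probability at most [b / #|T|]. *)
Lemma generic_sample (T : finType) (B : T -> T -> {set T}) (M b : nat) :
  (forall x y, #|B x y| <= b) -> M ^ 3 * b < #|T| ->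
  exists f : 'I_M -> T,
    forall i j l, l != i -> l != j -> f l \notin B (f i) (f j).
Proof.
move=> cB lt_b.
pose F := {ffun 'I_M -> T}.
pose bad (p : 'I_M * 'I_M * 'I_M) (f : F) :=
  [&& p.2 != p.1.1, p.2 != p.1.2 & f p.2 \in B (f p.1.1) (f p.1.2)].
have few_bad p : #|T| * #|[set f | bad p f]| <= #|F| * b.
  case: p => [[i j] l].
  pose upd (f : F) (z : T) : F := [ffun m => if m == l then z else f m].
  pose swap (p : F * T) := (upd p.1 p.2, p.1 l).
  have swapK : involutive swap.
    case=> f z; rewrite /swap /upd /= ffunE eqxx; congr pair.
    by apply/ffunP=> m; rewrite !ffunE; case: eqP => [->|].
  (* [B (f i) (f j)] ignores [f l], so exchanging [f l] with an independent [z]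
     reduces the count to the [z] that fall into a fixed set of size [<= b]. *)
  have -> : #|T| * #|[set f | bad (i, j, l) f]| =
      \sum_(p : F * T) bad (i, j, l) p.1.
    rewrite -(pair_bigA _ (fun f _ => bad (i, j, l) f : nat)) /=.
    rewrite -[X in _ * X]sum1_card big_distrr /= [RHS](bigID (bad (i, j, l))) /=.
    rewrite [X in _ + X]big1 ?addn0.
      apply: eq_big => [f|f]; rewrite ?inE // => ->.
      by rewrite sum_nat_const !muln1.
    by move=> f /negbTE->; rewrite big1.
  rewrite (reindex_inj (inv_inj swapK)) /=.
  rewrite -(pair_bigA _ (fun f z => bad (i, j, l) (upd f z) : nat)) /=.
  rewrite -sum_nat_const; apply: leq_sum => f _.
  apply: leq_trans (cB (f i) (f j)).
  rewrite -sum1_card [leqRHS]big_mkcond /=; apply: leq_sum => z _.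
  rewrite /bad /upd !ffunE eqxx /= ![_ == l]eq_sym.
  by case: eqP => //= _; case: eqP => //= _; case: (_ \in _).
have /existsP[f /forallP good] : [exists f : F, [forall p, ~~ bad p f]].
  apply: contraLR lt_b; rewrite negb_exists => /forallP allbad.
  rewrite -leqNgt.
  (* If [T] is empty, [F] may be empty too, and then [#|F|] cannot be cancelled. *)
  have T0 : 0 < #|F| \/ #|T| = 0.
    by case: (posnP #|T|) => [|T0]; [right|left; rewrite /F card_ffun expn_gt0 T0].
  case: T0 => [F0|->//]; rewrite -(leq_pmul2l F0).
  apply: (@leq_trans (\sum_p #|T| * #|[set f | bad p f]|)).
    rewrite mulnC -big_distrr leq_mul2l; apply/orP; right => /=.
    under eq_bigr do rewrite -sum1_card big_mkcond.
    rewrite exchange_big /= -sum1_card; apply: leq_sum => f _.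
    have := allbad f; rewrite negb_forall => /existsP[p].
    by rewrite negbK => badp; rewrite (bigD1 p) //= inE badp.
  apply: (@leq_trans (\sum_(p : 'I_M * 'I_M * 'I_M) #|F| * b)).
    by apply: leq_sum => p _; apply: few_bad.
  rewrite sum_nat_const !card_prod card_ord; lia.
exists f => i j l li lj; have := good (i, j, l).
by rewrite /bad /= li lj.
Qed.

(** * From a generic sample to 2-independent sets or subdivisions *)

Lemma dist_gt2_disjoint (G : sgraph) (x y : G) :
  [disjoint closed_nbhd x & closed_nbhd y] -> dist_gt 2 x y.
Proof.
move=> dis; rewrite /dist_gt /dist; case: pickP => //= n /andP[walk _].
rewrite ltnNge; apply/negP => le2.
have common v : v \in closed_nbhd x -> v \in closed_nbhd y -> False.
  by move=> vx vy; have := disjointFr dis vx; rewrite vy.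
move: walk le2; move: (val n) => {n} m /existsP[[p /= /eqP sp] /andP[]].
case: p sp => [|a [|b [|c p]]] /= <- //.
- by move=> _ /eqP xy _; apply: (common x); rewrite -?xy closed_nbhd_refl.
- rewrite andbT => xa /eqP ay _; apply: (common x).
    exact: closed_nbhd_refl.
  by rewrite -ay inE adj_sym xa orbT.
- rewrite andbT => /andP[xa ab] /eqP bY _; apply: (common a).
    by rewrite inE xa orbT.
  by rewrite -bY inE adj_sym ab orbT.
Qed.

(** The closed neighbourhoods that contain a middle vertex tell the ends of its edge, so distinct
    edges get distinct middle vertices. No middle vertex is a branch vertex, because [u i] lies in
    only one of these neighbourhoods. *)
Lemma contains_subdivision (G : sgraph) (k : nat) (u : 'I_k -> G) :
  (forall i l, l != i -> u i \notin closed_nbhd (u l)) ->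
  (forall i j, i != j -> exists v, forall l,
     (v \in closed_nbhd (u l)) = (l \in [set i; j])) ->
  contains_subgraph G (subdivision1 (complete_graph k)).
Proof.
move=> u_far u_common.
have edge2 (e : {e : {set complete_graph k} | e \in edges (complete_graph k)}) :
    exists2 p : 'I_k * 'I_k, p.1 != p.2 & val e = [set p.1; p.2].
  by case: e => e /= /imsetP[p]; rewrite inE => p12 ->; exists p.
have [g gP] : {g : {e | e \in edges (complete_graph k)} -> G |
    forall e l, (g e \in closed_nbhd (u l)) = (l \in val e)}.
  suff mid (e : {e | e \in edges (complete_graph k)}) :
      exists v, [forall l, (v \in closed_nbhd (u l)) == (l \in val e)].
    exists (fun e => xchoose (mid e)) => e l.
    by have /forallP/(_ l)/eqP := xchooseP (mid e).
  have [p p12 ->] := edge2 e; have [v vP] := u_common _ _ p12.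
  by exists v; apply/forallP=> l; rewrite vP.
have g_neq_u e i : g e != u i.
  apply/eqP=> gu; have [p p12 ep] := edge2 e.
  have only_i l : l \in val e -> l = i.
    by rewrite -gP gu; apply: contraTeq => /u_far; apply.
  have p1 : p.1 = i by apply: only_i; rewrite ep set21.
  have p2 : p.2 = i by apply: only_i; rewrite ep set22.
  by rewrite p1 p2 eqxx in p12.
exists (fun x => match x with inl i => u i | inr e => g e end); split.
- move=> [i|e] [j|e'] /= eq_im.
  + congr inl; apply/eqP/negPn/negP => /u_far.
    by rewrite eq_im closed_nbhd_refl.
  + by have := g_neq_u e' i; rewrite eq_im eqxx.
  + by have := g_neq_u e j; rewrite eq_im eqxx.
  + by congr inr; apply/val_inj/setP=> l; rewrite -!gP eq_im.
- have adj_mid i (e : {e | e \in edges (complete_graph k)}) : i \in val e -> adj (u i) (g e).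
    by rewrite -gP inE (negbTE (g_neq_u e i)).
  by move=> [i|e] [j|e'] //= /adj_mid; rewrite // adj_sym.
Qed.

Lemma two_independent_of_sample (G : sgraph) (k a : nat)
    (us : 'I_(2 ^ (k + a)) -> G) (c : G -> G -> G) :
  (forall x, c x x = x) ->
  (forall x y, ~~ [disjoint closed_nbhd x & closed_nbhd y] ->
     c x y \in closed_nbhd x :&: closed_nbhd y) ->
  (forall i j l, l != i -> l != j -> c (us i) (us j) \notin closed_nbhd (us l)) ->
  ~ contains_subgraph G (subdivision1 (complete_graph k)) ->
  a <= two_independence_number G.
Proof.
move=> cxx cP generic noK.
(* The case [i = j] of genericity makes the sampled vertices pairwise distinct
   and non-adjacent, so that no chosen common neighbour is itself sampled. *)
have far i l : l != i -> us i \notin closed_nbhd (us l).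
  by move=> li; rewrite -[us i]cxx generic.
have us_inj : injective us.
  move=> i j eq_us; apply/eqP/negPn/negP => /far.
  by rewrite eq_us closed_nbhd_refl.
pose meet i j := ~~ [disjoint closed_nbhd (us i) & closed_nbhd (us j)].
have meet_sym : symmetric meet by move=> i j; rewrite /meet disjoint_sym.
have [|[S [_ cS meetS]]|[S [_ cS disjS]]] :=
    @ramsey _ meet k a [set: 'I_(2 ^ (k + a))] meet_sym.
- by rewrite cardsT card_ord.
- case: noK; pose s (i : 'I_k) := enum_val (cast_ord (esym cS) i).
  have s_inj : injective s by move=> i j /enum_val_inj/cast_ord_inj.
  apply: (@contains_subdivision _ _ (us \o s)) => [i l li|i j ij] /=.
    by rewrite far // (inj_eq s_inj).
  exists (c (us (s i)) (us (s j))) => l.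
  have /setIP[ci cj] : c (us (s i)) (us (s j)) \in
      closed_nbhd (us (s i)) :&: closed_nbhd (us (s j)).
    by apply/cP/meetS; rewrite ?enum_valP // (inj_eq s_inj).
  rewrite in_set2; have [->|li] := eqVneq l i; first by rewrite ci.
  have [->|lj] := eqVneq l j; first by rewrite cj.
  by apply/negbTE/generic; rewrite (inj_eq s_inj).
- rewrite -cS -(card_imset _ us_inj) /two_independence_number.
  apply: (@leq_bigmax_cond _ _ (fun A : {set G} => #|A|)).
  apply/forall_inP=> _ /imsetP[i iS ->]; apply/forall_inP=> _ /imsetP[j jS ->].
  apply/implyP=> neq; apply: dist_gt2_disjoint.
  by have := disjS i j iS jS; rewrite /meet negbK; apply; apply: contraNneq neq => ->.
Qed.

(** * Choice of the constants and conclusion *)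

Theorem theorem9 (R : realType) (k : nat) (d : R) (hk : 3 <= k) (hd : (0 < d)%R) :
  domination_tied_to_2independence (class_C k d).
Proof.
have [D dD] : exists D : nat, (d <= D%:R)%R.
  by exists (Num.bound d); apply/ltW/archi_boundP/ltW.
pose M a := 2 ^ (k + a.+1).
(* With [n = #|G|], sampling [M a] of the [q a * n] positions requires
   [M a ^ 3 * (2n - 1) < q a * n]. *)
pose q a := 2 * M a ^ 3.
exists (fun a => (4 * D + 2) * (2 * q a)) => G [madG noK].
set a := two_independence_number G; rewrite leqNgt; apply/negP=> gamma_big.
have q0 : 0 < q a by rewrite muln_gt0 !expn_gt0.
have n0 : 0 < #|G|.
  apply: leq_ltn_trans (leq0n _) (leq_trans gamma_big _).
  rewrite -cardsT; apply: domination_number_le; apply/forallP=> v.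
  by rewrite inE.
have [o [o_adj adj_o oD]] := orientation_of_degenerate (@adj_sym G)
  (fun A => mad_degenerate dD madG).
have [w w0|us us_sparse] := @sparse_tuple G (@closed_nbhd G) (q a) q0 n0.
  (* Without such a [u], the rescaled [w] is a fractional dominating set of weight at most
     [2 * q a]. *)
  have [/existsP[u leu]|] := boolP [exists u,
    2 * q a * \sum_(v in closed_nbhd u) w v <= \sum_v w v]; first by exists u.
  rewrite negb_exists => /forallP heavy; move: gamma_big.
  rewrite ltnNge => /negP[]; apply: (fractional_domination_rounding o_adj adj_o oD w0) => u.
  by apply: ltnW; rewrite ltnNge.
pose c (x y : G) := if x == y then x
  else odflt x [pick v in closed_nbhd x :&: closed_nbhd y].
(* Positions of [us] are sampled rather than vertices, since a vertex may occur repeatedly. *)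
pose B i j := [set l | c (tnth us i) (tnth us j) \in closed_nbhd (tnth us l)].
have [i j||f fP] := @generic_sample _ B (M a) (2 * #|G|).-1.
- rewrite /B (count_tnth us (fun u => c _ _ \in closed_nbhd u)).
  by have := us_sparse (c (tnth us i) (tnth us j)); lia.
- rewrite card_ord {1}/q.
  have M0 : 0 < M a ^ 3 by rewrite !expn_gt0.
  by move: (M a ^ 3) (#|G|) M0 n0 => x y; nia.
suff : a.+1 <= a by rewrite ltnn.
apply: (@two_independent_of_sample G k a.+1 (fun i => tnth us (f i)) c) => //.
- by move=> x; rewrite /c eqxx.
- move=> x y meet; rewrite /c; case: eqP => [->|_].
    by rewrite setIid closed_nbhd_refl.
  case: pickP => //= none; case/negP: meet.
  by rewrite -setI_eq0; apply/eqP/setP=> v; rewrite none inE.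
- by move=> i j l li lj; have := fP i j l li lj; rewrite inE.
Qed.
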